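(* There exists a finite simple digraph $D$ with $\mathrm{NCW}(D) < \mathrm{SC}_\emptyset(D)$.
   Context: An abstract digraph decomposition of a digraph $D$ is a triple $(T,\beta,\gamma)$ with $T$ a rooted directed tree (edges directed away from the root), $\beta:V(T)\to 2^{V(D)}$, $\gamma:E(T)\to 2^{V(D)}$, $\bigcup_t\beta(t)=V(D)$. Let $\Gamma(t)=\beta(t)\cup\bigcup_{e\text{ incident with }t}\gamma(e)$, $T_t$ the subtree of nodes reachable from $t$, $\beta(T_t)=\bigcup_{t'\in V(T_t)}\beta(t')$; width $=\max_t|\Gamma(t)|-1$. An NCW-directed tree decomposition: $\{\beta(t)\}$ is a partition of $V(D)$ into nonempty sets, and for every $e=(s,t)\in E(T)$ there is no closed walk in $D-\gamma(e)$ containing a vertex of $\beta(T_t)$ and a vertex of $V(D)-\beta(T_t)$; $\mathrm{NCW}(D)$ is the minimum width of one. An $\mathrm{SC}_\emptyset$-directed tree decomposition: $\{\beta(t)\}$ is a partition of $V(D)$ into possibly empty sets with nonempty root bag; for every $e=(s,t)\in E(T)$, $\beta(T_t)$ is the vertex set of a strong component of $D-\gamma(e)$; and $|V(T)|\le|V(D)|^2$; $\mathrm{SC}_\emptyset(D)$ is the minimum width of one. *)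

(* Defs.v *)
From HB Require Import structures.
From mathcomp Require Import all_boot.

Set Implicit Arguments.
Unset Strict Implicit.
Unset Printing Implicit Defensive.

(* Finite simple digraph: no loops, no parallel edges; edges in both directions
   between two vertices are allowed. *)
Record digraph := Digraph {
  vertex :> finType;
  edge : rel vertex;
  edge_irr : irreflexive edge
}.

(* Edge relation of D - X. Vertices of X are still present in the type, as
   isolated vertices, so they have to be excluded where this matters. *)
Definition edge_del (D : digraph) (X : {set D}) : rel D :=
  [rel x y | [&& edge x y, x \notin X & y \notin X]].

Definition closed_walk_del (D : digraph) (X : {set D}) (c : seq D) : bool :=
  cycle (edge_del X) c.

(* Vertex sets of the strong components of D - X: the classes of mutual
   reachability on the vertices outside X. *)
Definition strong_components_del (D : digraph) (X : {set D}) : {set {set D}} :=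
  equivalence_partition
    [rel x y | connect (edge_del X) x y && connect (edge_del X) y x] (~: X).

(* Rooted directed tree with all edges directed away from r: every node is the
   end of exactly one directed walk from r. *)
Definition arborescence (N : finType) (te : rel N) (r : N) : Prop :=
  forall t : N, exists! p : seq N, path te r p /\ last r p = t.

(* [guard s t] is gamma(e) for the tree edge e = (s, t); its values at pairs
   that are not tree edges are never used. *)
Record decomposition (D : digraph) := Decomposition {
  node : finType;
  tedge : rel node;
  troot : node;
  tree_axiom : arborescence tedge troot;
  bag : node -> {set D};
  guard : node -> node -> {set D};
  bag_cover : \bigcup_(t : node) bag t = [set: D]
}.

Section Decomposition.
Variables (D : digraph) (d : decomposition D).

Definition Gamma (t : node d) : {set D} :=
  bag t :|: (\bigcup_(s | tedge s t) guard s t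
             :|: \bigcup_(s | tedge t s) guard t s).

Definition bag_below (t : node d) : {set D} :=
  \bigcup_(t' | connect (@tedge D d) t t') bag t'.

(* The truncated predecessor is harmless: the decompositions below have a
   nonempty root bag, so the maximum is positive. *)
Definition width : nat := (\max_(t : node d) #|Gamma t|).-1.

Definition bags_disjoint : Prop :=
  forall s t : node d, s != t -> [disjoint bag s & bag t].

Definition is_NCW_decomposition : Prop :=
  [/\ bags_disjoint,
      forall t : node d, bag t != set0
    & forall s t : node d, tedge s t ->
        ~ exists c : seq D,
            [/\ closed_walk_del (guard s t) c,
                exists2 x, x \in c & x \in bag_below t
              & exists2 y, y \in c & y \notin bag_below t]].

Definition is_SC0_decomposition : Prop :=
  [/\ bags_disjoint,
      bag (troot d) != set0,
      forall s t : node d, tedge s t ->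
        bag_below t \in strong_components_del (guard s t)
    & #|node d| <= #|D| ^ 2].

End Decomposition.

Definition is_minimum (P : nat -> Prop) (n : nat) : Prop :=
  P n /\ forall m : nat, P m -> n <= m.

(* [NCW D k] reads NCW(D) = k, and [SC0 D k] reads SC_emptyset(D) = k. *)
Definition NCW (D : digraph) (k : nat) : Prop :=
  is_minimum
    (fun w => exists2 d : decomposition D, is_NCW_decomposition d & width d = w)
    k.

Definition SC0 (D : digraph) (k : nat) : Prop :=
  is_minimum
    (fun w => exists2 d : decomposition D, is_SC0_decomposition d & width d = w)
    k.

(* Main.v *)
(** The digraph consists of two hubs, joined in both directions, and two copies
    of a part {a, b, c, d0, d1} attached to them.  Each part is a complete
    bidirected graph minus the pair ac; the hubs have edges in both directions
    to a, edges to d0 and d1, and edges from c.  Thus {a, c} cuts all edges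
    leaving a part, and {a, d0, d1} all edges entering it.

    An NCW decomposition of width 3 separates a part from the hubs by the guard
    {a, c}, and then replaces this guard by {a, d0, d1}: the vertex c is given
    up and stays below the new guard.  An SC decomposition cannot do this,
    since its sets beta(T_t) avoid the guard.  If all its sets Gamma(t) have at
    most 4 elements, induction from the leaves shows that every beta(T_t) with
    t not the root lies in some {b, c}, with {d0, d1} and one of a, b in the
    guard.  Then at the root 4 + 2 vertices would exhaust the digraph. *)

Require Import Defs.
From HB Require Import structures.
From mathcomp Require Import all_boot.
From Stdlib Require Import Classical.

Set Implicit Arguments.
Unset Strict Implicit.
Unset Printing Implicit Defensive.

(** * Minima of predicates, and reachability in relations *)

(** [P] need not be decidable, hence the excluded middle. The bound [k <= n] lets a single
    decomposition bound the minimum from above. *)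
Lemma is_minimum_exists (P : nat -> Prop) (n : nat) :
  P n -> exists k, is_minimum P k /\ k <= n.
Proof.
elim/ltn_ind: n => n IHn Pn.
case: (classic (exists2 m, P m & m < n)) => [[m Pm lt_mn]|noP].
  have [k [Pk le_km]] := IHn m lt_mn Pm.
  by exists k; split; last exact: leq_trans le_km (ltnW lt_mn).
exists n; split=> //; split=> // m Pm; rewrite leqNgt; apply/negP => lt_mn.
by apply: noP; exists m.
Qed.

Lemma connect_stable (T : finType) (e : rel T) (S : {set T}) (x y : T) :
  (forall u v, e u v -> u \in S -> v \in S) ->
  connect e x y -> x \in S -> y \in S.
Proof.
move=> stS /connectP[p + ->]; elim: p x => //= u p IHp x /andP[xu up] Sx.
exact: IHp up (stS _ _ xu Sx).
Qed.

Lemma connect_costable (T : finType) (e : rel T) (S : {set T}) (x y : T) :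
  (forall u v, e u v -> v \in S -> u \in S) ->
  connect e x y -> y \in S -> x \in S.
Proof.
move=> stS xy; apply: contraLR; rewrite -!in_setC.
by apply: connect_stable xy => u v /stS uv; rewrite !inE; apply: contra.
Qed.

Lemma connect_step (T : finType) (e : rel T) (x y : T) :
  connect e x y = (x == y) || [exists z, e x z && connect e z y].
Proof.
apply/idP/orP=> [/connectP[[|z p] /=]|[/eqP->|/existsP[z /andP[xz zy]]]].
- by move=> _ ->; left.
- move=> /andP[xz zp] ->; right; apply/existsP; exists z; rewrite xz.
  by apply/connectP; exists p.
- exact: connect0.
- exact: connect_trans (connect1 xz) zy.
Qed.

(** * Rooted directed trees *)

Section Arborescence.
Variables (N : finType) (te : rel N) (r : N).

(** Two walks from [r] to the same node are compared from their ends: predecessors are unique, and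
    as no edge enters [r], both walks run out together. *)
Lemma arborescence_intro :
  (forall s, ~~ te s r) ->
  (forall s s' t, te s t -> te s' t -> s = s') ->
  (forall t, connect te r t) -> arborescence te r.
Proof.
move=> te_r te_inj r_conn t; have /connectP[p rp pt] := r_conn t.
exists p; split=> // q [rq qt]; rewrite pt in qt.
elim/last_ind: p q rp rq qt {pt} => [|p x IHp] q;
    case/lastP: q => [|q y] //=.
- by rewrite rcons_path last_rcons => _ /andP[_ +] yr; rewrite yr (negPf (te_r _)).
- by rewrite rcons_path last_rcons => /andP[_ +] _ rx; rewrite -rx (negPf (te_r _)).
- rewrite !rcons_path !last_rcons => /andP[rp px] /andP[rq qy] yx.
  by rewrite yx in qy *; rewrite (IHp q rp rq) // (te_inj _ _ _ px qy).
Qed.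

Hypothesis arb : arborescence te r.

Lemma arborescence_connect (t : N) : connect te r t.
Proof. by have [p [[rp pt] _]] := arb t; apply/connectP; exists p. Qed.

(** A walk from [u] back to [t] would prolong the walk from the root to [t] into a second one. *)
Lemma arborescence_acyclic (t u : N) : te t u -> ~~ connect te u t.
Proof.
move=> tu; apply/negP => /connectP[q uq qt].
have [p [[rp pt] p_uniq]] := arb t.
have /p_uniq : path te r (p ++ u :: q) /\ last r (p ++ u :: q) = t.
  by rewrite cat_path last_cat /= rp pt tu uq.
by move/(congr1 size)/eqP; rewrite size_cat -[X in X == _]addn0 eqn_add2l.
Qed.

Lemma arborescence_ind (P : N -> Prop) :
  (forall t, (forall u, te t u -> P u) -> P t) -> forall t, P t.
Proof.
move=> IH t; have [n] := ubnP #|connect te t|.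
elim: n t => // n IHn t /ltnSE le_tn; apply: IH => u tu; apply: IHn.
apply: leq_trans le_tn; apply: proper_card; apply/properP; split.
  by apply/subsetP => v; apply: connect_trans (connect1 tu).
by exists t; [exact: connect0 | exact: arborescence_acyclic].
Qed.

End Arborescence.

(** * Bags below a node, closed walks and strong components *)

Section Decompositions.
Variables (D : digraph).

Lemma bag_below_step (d : decomposition D) (t : node d) :
  bag_below t = bag t :|: \bigcup_(u | tedge t u) bag_below u.
Proof.
apply/setP => v; rewrite in_setU; apply/bigcupP/orP=> [[t']|].
  rewrite connect_step => /orP[/eqP<-|/existsP[u /andP[tu ut']]] vt'; first by left.
  by right; apply/bigcupP; exists u => //; apply/bigcupP; exists t'.
case=> [vt|/bigcupP[u tu /bigcupP[t' ut' vt']]]; first by exists t.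
by exists t' => //; apply: connect_trans ut'; apply: connect1.
Qed.

Lemma bag_below_root (d : decomposition D) : bag_below (troot d) = [set: D].
Proof.
apply/setP => v; rewrite -(bag_cover d); apply/bigcupP/bigcupP => -[t _ vt];
  exists t => //; exact: (arborescence_connect (@tree_axiom D d)).
Qed.

(** A closed walk that crosses a cut crosses it in both directions, so it is enough to block one of
    them. *)
Lemma closed_walk_stable (X S : {set D}) :
  (forall u v, edge_del X u v -> u \in S -> v \in S) \/
  (forall u v, edge_del X u v -> v \in S -> u \in S) ->
  ~ exists c : seq D,
      [/\ closed_walk_del X c,
          exists2 x, x \in c & x \in S & exists2 y, y \in c & y \notin S].
Proof.
move=> stS [c [cyc [x xc xS] [y yc /negP]]]; apply; case: stS => stS.
  exact: connect_stable stS (connect_cycle cyc xc yc) xS.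
exact: connect_costable stS (connect_cycle cyc yc xc) xS.
Qed.

Section StrongComponent.
Variables (X C : {set D}).
Hypothesis scC : C \in strong_components_del X.

Lemma strong_component_neq0 : exists x, x \in C.
Proof.
have /imsetP[x xX ->] := scC; exists x.
by rewrite inE xX /= connect0.
Qed.

Lemma strong_component_notin (x : D) : x \in C -> x \notin X.
Proof. by have /imsetP[z _ ->] := scC; rewrite !inE => /andP[]. Qed.

Lemma strong_component_connect (x y : D) :
  x \in C -> y \in C -> connect (edge_del X) x y.
Proof.
have /imsetP[z _ ->] := scC.
rewrite !inE => /and3P[_ _ xz] /and3P[_ zy _]; exact: connect_trans xz zy.
Qed.

Lemma strong_component_cycle (c : seq D) (x y : D) :
  closed_walk_del X c -> x \in c -> y \in c -> x \in C -> y \in C.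
Proof.
move=> cyc xc yc; have /imsetP[z _ ->] := scC.
rewrite !inE => /and3P[_ zx xz].
(* The edge of the walk that leaves [y] shows that [y] is outside [X]. *)
have /and3P[_ -> _] := next_cycle cyc yc; rewrite /=.
by rewrite (connect_trans zx (connect_cycle cyc xc yc))
           (connect_trans (connect_cycle cyc yc xc) xz).
Qed.

(** Every vertex of [C] reaches [x], and so lies in each predecessor-closed set around [x]. *)
Lemma strong_component_sub (S : {set D}) (x : D) :
  x \in C -> x \in S ->
  (forall u v, edge_del X u v -> v \in S -> u \in S) -> C \subset S.
Proof.
move=> xC xS stS; apply/subsetP => y yC.
exact: connect_costable stS (strong_component_connect yC xC) xS.
Qed.

Lemma strong_component_two_way (x y : D) :
  x \in C -> edge x y -> edge y x -> y \in C :|: X.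
Proof.
move=> xC xy yx; rewrite in_setU; case: (boolP (y \in X)) => [|yX]; rewrite ?orbT //.
rewrite (@strong_component_cycle [:: x; y] x) ?inE ?eqxx ?orbT //=.
by rewrite /closed_walk_del /= /edge_del /= xy yx yX strong_component_notin.
Qed.

End StrongComponent.

Lemma trivial_arborescence :
  arborescence (fun _ _ : unit => false) tt.
Proof. by case; exists [::]; split=> // -[|x p] [] //=. Qed.

Lemma trivial_cover : \bigcup_(t : unit) [set: D] = [set: D].
Proof. by apply/setP => v; rewrite !inE; apply/bigcupP; exists tt; rewrite ?inE. Qed.

Definition trivial_decomposition : decomposition D :=
  Decomposition trivial_arborescence (fun _ _ => set0) trivial_cover.

(** This makes the set of widths nonempty, so that the minimum exists. *)
Lemma trivial_is_SC0 : 0 < #|D| -> is_SC0_decomposition trivial_decomposition.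
Proof.
move=> D_gt0; split=> /=.
- by case=> -[].
- by rewrite -card_gt0 cardsT.
- by [].
- by rewrite card_unit expn_gt0 D_gt0.
Qed.

End Decompositions.

(** * The digraph *)

(* [Pd false] and [Pd true] are twins; they make the cut entering a part larger
   than the cut leaving it. *)
Inductive part := Pa | Pb | Pc | Pd of bool.

Definition part_code (x : part) : option (option (option bool)) :=
  match x with
  | Pa => None | Pb => Some None | Pc => Some (Some None)
  | Pd i => Some (Some (Some i))
  end.

Definition part_decode (y : option (option (option bool))) : part :=
  match y with
  | None => Pa | Some None => Pb | Some (Some None) => Pc
  | Some (Some (Some i)) => Pd i
  end.

Lemma part_codeK : cancel part_code part_decode.
Proof. by case. Qed.

HB.instance Definition _ := Finite.copy part (can_type part_codeK).

Definition vtx : finType := (bool + bool * part)%type.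

(* [inl i] is a hub, [inr (j, x)] the vertex x of the j-th part. *)
Definition arc (u v : vtx) : bool :=
  match u, v with
  | inl i, inl i' => i != i'
  | inl _, inr (_, x) => if x is (Pa | Pd _) then true else false
  | inr (_, x), inl _ => if x is (Pa | Pc) then true else false
  | inr (j, x), inr (j', y) =>
      (j == j') && match x, y with
                   | Pa, Pc | Pc, Pa => false
                   | _, _ => x != y
                   end
  end.

Lemma arc_irr : irreflexive arc.
Proof. by case=> [i|[j [|||i]]] /=; rewrite ?eqxx. Qed.

Definition gadget : digraph := Digraph arc_irr.

(** * Lower bound for SC decompositions *)

(** The invariant of a tree edge with guard [X] and vertices [C] below it. That [C] contains c
    allows the weaker bound 6 one level higher in the tree. *)
Definition good_state (C X : {set gadget}) : Prop :=
  exists j : bool,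
    [/\ inr (j, Pc) \in C, C \subset [set inr (j, Pb); inr (j, Pc)],
        forall i, inr (j, Pd i) \in X
      & (inr (j, Pa) \in X) || (inr (j, Pb) \in X)].

Lemma card_seq_le (T : finType) (A : {set T}) (s : seq T) (n : nat) :
  #|A| <= n -> uniq s -> n < size s -> ~~ all [in A] s.
Proof.
move=> le_An /card_uniqP card_s lt_ns; apply/negP => /allP sA.
have: #|s| <= #|A| by apply: subset_leq_card; apply/subsetP.
by rewrite card_s leqNgt (leq_ltn_trans le_An).
Qed.

Section SmallComponent.
Variables (X C : {set gadget}).
Hypothesis scC : C \in strong_components_del X.

(* Each hub lies with d_i and c on a directed triangle: hub -> d_i -> c -> hub. *)
Lemma component_hub_walk (i j k : bool) (x y : gadget) :
  inl k \notin X -> inr (j, Pd i) \notin X -> inr (j, Pc) \notin X ->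
  x \in [:: inl k; inr (j, Pd i); inr (j, Pc)] ->
  y \in [:: inl k; inr (j, Pd i); inr (j, Pc)] -> x \in C -> y \in C.
Proof.
move=> rX dX cX; apply: (strong_component_cycle scC).
by rewrite /closed_walk_del /= /edge_del /= rX dX cX eqxx.
Qed.

Lemma component_good_of_c (j : bool) :
  #|C :|: X| <= 6 -> inr (j, Pc) \in C -> good_state C X.
Proof.
move=> le6 cC.
have memY v : v \in C -> v \in C :|: X by rewrite in_setU => ->.
have memC v : v \notin X -> v \in C :|: X -> v \in C.
  by rewrite in_setU orbC => /negPf->.
have two := strong_component_two_way scC.
(* The neighbours of a vertex in both directions stay in [C :|: X], so dropping
   d_i, or both a and b, from [X] would force these seven vertices into it. *)
have seven : ~~ all [in C :|: X]
    [:: inl true; inl false; inr (j, Pa); inr (j, Pb); inr (j, Pc);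
        inr (j, Pd true); inr (j, Pd false)].
  by apply: card_seq_le le6 _ _; case: (j).
have pX i : inr (j, Pd i) \in X.
  apply/negPn/negP => pX; apply: negP seven _.
  have pC : inr (j, Pd i) \in C.
    by apply: memC => //; apply: two cC _ _; rewrite /= ?eqxx.
  have rY k : inl k \in C :|: X.
    rewrite in_setU; case: (boolP (inl k \in X)) => [|rX]; rewrite ?orbT //.
    rewrite (component_hub_walk rX pX (strong_component_notin scC cC) _ _ cC) //;
      by rewrite !inE eqxx ?orbT.
  have dY i' : inr (j, Pd i') \in C :|: X.
    case: (eqVneq i' i) => [->|ne]; first exact: memY.
    apply: two pC _ _; rewrite /= eqxx //=; first by rewrite eq_sym.
  rewrite /= !rY !dY (memY _ cC).
  by rewrite !(two _ _ pC) //= ?eqxx.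
have abX : (inr (j, Pa) \in X) || (inr (j, Pb) \in X).
  apply/negPn; rewrite negb_or; apply/negP => /andP[aX bX].
  apply: negP seven _.
  have bC : inr (j, Pb) \in C by apply: memC => //; apply: two cC _ _; rewrite /= eqxx.
  have aC : inr (j, Pa) \in C by apply: memC => //; apply: two bC _ _; rewrite /= eqxx.
  rewrite /= (memY _ cC) (memY _ bC) (memY _ aC) !in_setU !pX !orbT.
  by rewrite -!in_setU !(two _ _ aC).
(* All in-neighbours of b and c lie in the part. Hence {b, c} is predecessor-closed when a and both
   d_i are deleted, and {c} when b and both d_i are. *)
exists j; split=> //; case/orP: abX => [aX|bX].
  apply: (strong_component_sub scC cC); rewrite ?inE ?eqxx ?orbT //.
  move=> u v /and3P[uv uX _]; rewrite !inE => vbc.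
  move: uX uv; case/orP: vbc => /eqP->; case: u => [k|[j' [|||k]]] //= uX;
    rewrite ?andbF ?andbT // => /eqP E; subst j'; rewrite ?eqxx ?orbT //;
    by rewrite ?aX ?pX in uX.
apply: (@subset_trans _ _ [set inr (j, Pc)]); last by apply/subsetP => v; rewrite !inE => ->; rewrite orbT.
apply: (strong_component_sub scC cC); rewrite ?inE ?eqxx ?orbT //.
move=> u v /and3P[uv uX _]; rewrite !inE => /eqP vc.
move: uX uv; rewrite vc; case: u => [k|[j' [|||k]]] //= uX;
  rewrite ?andbF ?andbT // => /eqP E; subst j'; rewrite ?eqxx //;
  by rewrite ?bX ?pX in uX.
Qed.

(** Two-way neighbours of a vertex of [C] stay in [C :|: X]. Each of a, b, d_i has at least four of
    them, too many. A hub has three, which with it fill [C :|: X]; yet the directed triangle through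
    d_i and c would then add c. Only c remains. *)
Lemma component_good_of_card : #|C :|: X| <= 4 -> good_state C X.
Proof.
move=> le4; have [v vC] := strong_component_neq0 scC.
have two := strong_component_two_way scC.
have memY : v \in C :|: X by rewrite in_setU vC.
have five s : uniq s -> 4 < size s -> ~~ all [in C :|: X] s := card_seq_le le4.
case: v vC memY => [i|[j [|||i]]] vC vY.
- have rY k : inl k \in C :|: X.
    by case: (eqVneq k i) => [->//|ki]; apply: two vC _ _; rewrite /= // eq_sym.
  have aY j : inr (j, Pa) \in C :|: X by apply: two vC _ _.
  have := five [:: inl true; inl false; inr (true, Pa); inr (false, Pa); inr (true, Pd true)] isT isT.
  rewrite /= !rY !aY /= andbT in_setU negb_or => /andP[_ dX].
  have := five [:: inl true; inl false; inr (true, Pa); inr (false, Pa); inr (true, Pc)] isT isT.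
  rewrite /= !rY !aY /= andbT in_setU negb_or => /andP[cC cX].
  case/negP: cC.
  apply: (component_hub_walk (strong_component_notin scC vC) dX cX _ _ vC);
    by rewrite !inE eqxx ?orbT.
- have := five [:: inr (j, Pa); inl true; inl false; inr (j, Pb); inr (j, Pd true)].
  by rewrite /= vY !(two _ _ vC) //= ?eqxx //; case: (j) => /(_ isT isT).
- have := five [:: inr (j, Pb); inr (j, Pa); inr (j, Pc); inr (j, Pd false); inr (j, Pd true)].
  by rewrite /= vY !(two _ _ vC) //= ?eqxx //; case: (j) => /(_ isT isT).
- exact: component_good_of_c (leq_trans le4 _) vC.
- have := five [:: inr (j, Pd i); inr (j, Pa); inr (j, Pb); inr (j, Pc); inr (j, Pd (~~ i))].
  rewrite /= vY !(two _ _ vC) //= ?eqxx //=; try by case: (i).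
  by case: (i); case: (j) => /(_ isT isT).
Qed.

End SmallComponent.

Lemma SC0_width_gt3 (d : decomposition gadget) :
  is_SC0_decomposition d -> 3 < width d.
Proof.
case=> _ _ sc_below _; rewrite ltnNge; apply/negP => le3.
have le4 (t : node d) : #|Gamma t| <= 4.
  have : #|Gamma t| <= (width d).+1.
    exact: leq_trans (leq_bigmax t) (leqSpred _).
  by move/leq_trans; apply.
have le6 (t : node d) j : #|Gamma t :|: [set inr (j, Pb); inr (j, Pc)]| <= 6.
  apply: leq_trans (leq_card_setU _ _) _; rewrite -[6]/(4 + 2).
  by apply: leq_add (le4 t) _; rewrite cards2; case: (_ != _).
have sub_Gamma (s t : node d) : tedge s t -> guard s t \subset Gamma s /\ guard s t \subset Gamma t.
  move=> st; split; apply/subsetP => v vg; rewrite !in_setU.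
    by apply/or3P/Or33; apply/bigcupP; exists t.
  by apply/or3P/Or32; apply/bigcupP; exists s.
(* Either the bound 4 holds for the whole set below [t], or a child brings in c and the bound 6 is
   enough. *)
have step (t : node d) : (forall u, tedge t u -> good_state (bag_below u) (guard t u)) ->
    exists j, bag_below t \subset Gamma t :|: [set inr (j, Pb); inr (j, Pc)] /\
      (bag_below t \subset Gamma t \/ inr (j, Pc) \in bag_below t).
  move=> goodt.
  have [/existsP[u tu]|] := boolP [exists u, tedge t u].
    have [j [cu subu pX abX]] := goodt u tu; exists j; split; last first.
      by right; rewrite bag_below_step in_setU; apply/orP; right; apply/bigcupP; exists u.
    rewrite bag_below_step subUset; apply/andP; split.
      by apply/subsetP => v vt; rewrite !in_setU vt.
    apply/bigcupsP => u' tu'; have [j' [_ subu' pX' _]] := goodt u' tu'.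
    suff -> : j = j' by apply: subset_trans subu' (subsetUr _ _).
    (* Children in different parts would put all four d-vertices and one of a, b into [Gamma t]. *)
    apply/eqP/negPn/negP => jj'.
    have [/subsetP gt _] := sub_Gamma _ _ tu; have [/subsetP gt' _] := sub_Gamma _ _ tu'.
    have abG : exists x, [/\ x \in Gamma t & x \in [:: inr (j, Pa); inr (j, Pb)]].
      by case/orP: abX => /gt xG; [exists (inr (j, Pa)) | exists (inr (j, Pb))];
        split=> //; rewrite !inE eqxx ?orbT.
    have [x [xG xab]] := abG.
    have := card_seq_le (s := [:: x; inr (j, Pd true); inr (j, Pd false);
             inr (j', Pd true); inr (j', Pd false)]) (le4 t).
    rewrite /= xG !(gt _ (pX _)) !(gt' _ (pX' _)).
    move: xab jj'; rewrite !inE => /orP[] /eqP->; by case: (j); case: (j') => // _ /(_ isT isT).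
  rewrite negb_exists => /forallP leaf; exists true.
  suff sub : bag_below t \subset Gamma t by split; [exact: subset_trans sub (subsetUl _ _) | left].
  rewrite bag_below_step subUset subsetUl; apply/bigcupsP => u tu.
  by rewrite (negPf (leaf u)) in tu.
have good (t : node d) : forall s, tedge s t -> good_state (bag_below t) (guard s t).
  elim/(arborescence_ind (@tree_axiom _ d)): t => t IHt s st.
  have [j [sub6 or4]] := step t (fun u tu => IHt u tu t tu).
  have [_ subX] := sub_Gamma _ _ st.
  have scC := sc_below _ _ st.
  case: or4 => [sub4|cC].
    apply: component_good_of_card scC _; apply: leq_trans (le4 t).
    by apply: subset_leq_card; rewrite subUset sub4.
  refine (component_good_of_c scC _ cC); apply: leq_trans (le6 t j).
  by apply: subset_leq_card; rewrite subUset sub6 (subset_trans subX) ?subsetUl.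
have [j [+ _]] := step (troot d) (fun u tu => good u _ tu).
rewrite bag_below_root => /subset_leq_card le_all.
have : ~~ all [in [set: gadget]]
    [:: inl true; inl false; inr (j, Pa); inr (j, Pb); inr (j, Pc);
        inr (j, Pd true); inr (j, Pd false)].
  by apply: card_seq_le (leq_trans le_all (le6 _ _)) _ _; case: (j).
by rewrite /= !in_setT.
Qed.

(** * An NCW decomposition of width at most 3 *)

(* The root holds the hubs; below it hangs for each part a path of four nodes,
   whose bags are {a}, {d0, d1}, {b}, {c}. *)
Definition ncw_node : finType := option (bool * 'I_4).

Definition ncw_edge (s t : ncw_node) : bool :=
  match s, t with
  | None, Some (_, i) => i == 0 :> nat
  | Some (j, i), Some (j', i') => (j == j') && (i' == i.+1 :> nat)
  | _, None => false
  end.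

Definition part_pos (x : part) : 'I_4 :=
  match x with
  | Pa => @Ordinal 4 0 isT | Pd _ => @Ordinal 4 1 isT | Pb => @Ordinal 4 2 isT | Pc => @Ordinal 4 3 isT
  end.

Definition ncw_bag (t : ncw_node) : {set gadget} :=
  [set v : vtx | t == match v with
                      | inl _ => None
                      | inr (j, x) => Some (j, part_pos x)
                      end].

(** In the second guard, [Pc] also lies below the tree edge, which an NCW decomposition permits. *)
Definition ncw_guard (s t : ncw_node) : {set gadget} :=
  if t is Some (j, i) then
    [set v in nth [::] [:: [:: inl true; inl false];
                           [:: inr (j, Pa); inr (j, Pc)];
                           [:: inr (j, Pa); inr (j, Pd true); inr (j, Pd false)];
                           [:: inr (j, Pb); inr (j, Pd true); inr (j, Pd false)]] i]
  else set0.

(** Closed form of [bag_below], which turns the guard condition into a finite check. *)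
Definition ncw_below (t : ncw_node) : {set gadget} :=
  if t is Some (j, i) then
    [set v : vtx | if v is inr (j', x) then (j' == j) && (i <= part_pos x) else false]
  else setT.

Lemma ncw_arborescence : arborescence ncw_edge None.
Proof.
apply: arborescence_intro.
- by case=> [[]|].
- move=> [[j i]|] [[j' i']|] [[k l]|] //=.
  + move=> /andP[/eqP-> /eqP->] /andP[/eqP-> /eqP[/val_inj->]] //.
  + by move=> /andP[_ /eqP->].
  + by move=> /eqP-> /andP[].
- case=> [[j [i lti]]|]; last exact: connect0.
  elim: i lti => [|i IHi] lti; first exact: connect1.
  apply: connect_trans (IHi (ltnW lti)) (connect1 _).
  by rewrite /= !eqxx.
Qed.

Lemma ncw_cover : \bigcup_(t : ncw_node) ncw_bag t = [set: gadget].
Proof.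
apply/setP => v; rewrite in_setT; apply/bigcupP.
by eexists; last (rewrite inE; exact: eqxx).
Qed.

Definition ncw_decomposition : decomposition gadget :=
  Decomposition ncw_arborescence ncw_guard ncw_cover.

Lemma ncw_bag_below (t : node ncw_decomposition) : bag_below t = ncw_below t.
Proof.
elim/(arborescence_ind ncw_arborescence): t => t IHt.
rewrite bag_below_step (eq_bigr _ IHt); apply/setP => v; rewrite in_setU.
apply/orP/idP => [[]|].
- rewrite inE => /eqP->; case: v => [i|[j x]] /=; first by rewrite in_setT.
  by rewrite inE eqxx leqnn.
- case/bigcupP => -[[k l]|]; case: t {IHt} => [[j i]|] //=; last by rewrite in_setT.
  case/andP => /eqP<- /eqP->.
  by rewrite !inE; case: v => [|[j' x]] // /andP[-> /ltnW].
- case: t {IHt} => [[j i]|]; case: v => [k|[j' x]]; rewrite ?inE //=.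
  + case/andP=> /eqP->; rewrite leq_eqVlt => /orP[/eqP/val_inj->|lt_ix]; first by left.
    right; apply/bigcupP; exists (Some (j, Ordinal (leq_ltn_trans lt_ix (ltn_ord _)))).
      by rewrite /= !eqxx.
    by rewrite inE eqxx.
  + by left.
  + by right; apply/bigcupP; exists (Some (j', ord0)) => //; rewrite inE eqxx.
Qed.

Lemma ncw_is_NCW : is_NCW_decomposition ncw_decomposition.
Proof.
split.
- move=> s t /eqP st; rewrite -setI_eq0; apply/eqP/setP => v.
  by rewrite !inE; apply/negP => /andP[/eqP sv /eqP tv]; case: st; rewrite sv tv.
- case=> [[j i]|]; apply/set0Pn; last by exists (inl true); rewrite inE.
  have [x ->] : exists x, i = part_pos x.
    case: i => [[|[|[|[|//]]]] lti];
      [exists Pa | exists (Pd true) | exists Pb | exists Pc];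
      by apply: val_inj; rewrite /= .
  by exists (inr (j, x)); rewrite inE.
move=> s [[j i]|]; last by case: s => [[]|].
move=> _; rewrite ncw_bag_below; apply: closed_walk_stable.
(* The first two guards block every edge leaving the set below, the last two every edge entering
   it. *)
by case: i => [[|[|[|[|//]]]] lti]; [left | left | right | right]; move=> u v /and3P[];
  rewrite !inE /=; case: j; case: u => [[]|[[] [|||[]]]]; case: v => [[]|[[] [|||[]]]].
Qed.

Lemma ncw_width : width ncw_decomposition <= 3.
Proof.
(* Each list unites the bag with the guards of the incident tree edges. *)
pose gam (t : ncw_node) : seq gadget :=
  if t is Some (j, i) then
    nth [::] [:: [:: inl true; inl false; inr (j, Pa); inr (j, Pc)];
                 [:: inr (j, Pa); inr (j, Pc); inr (j, Pd true); inr (j, Pd false)];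
                 [:: inr (j, Pa); inr (j, Pb); inr (j, Pd true); inr (j, Pd false)];
                 [:: inr (j, Pb); inr (j, Pc); inr (j, Pd true); inr (j, Pd false)]] i
  else [:: inl true; inl false].
have sub_gam (t : node ncw_decomposition) : Gamma t \subset gam t.
  apply/subsetP => v; rewrite !in_setU => /or3P[].
  - by case: t => [[[] [[|[|[|[|//]]]] lti]]|]; rewrite inE; case: v => [[]|[[] [|||[]]]].
  - by case/bigcupP => s _; case: t => [[[] [[|[|[|[|//]]]] lti]]|];
      rewrite inE //=; case: v => [[]|[[] [|||[]]]].
  - case/bigcupP => -[[k l]|]; case: t => [[j i]|] //=.
      case/andP => /eqP<- /eqP->.
      by case: j; case: i => [[|[|[|[|//]]]] lti]; rewrite inE; case: v => [[]|[[] [|||[]]]].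
    by move/eqP->; rewrite inE; case: v => [[]|[[] [|||[]]]].
have le4 (t : node ncw_decomposition) : #|Gamma t| <= 4.
  apply: leq_trans (subset_leq_card (sub_gam t)) _; apply: leq_trans (card_size _) _.
  by case: t => [[j [[|[|[|[|//]]]] lti]]|].
rewrite /width -subn1 leq_subLR; exact/bigmax_leqP.
Qed.

Theorem theorem4p15 :
  exists (D : digraph) (k l : nat), NCW D k /\ SC0 D l /\ k < l.
Proof.
have [k [NCWk le_k]] := @is_minimum_exists
  (fun w => exists2 d : decomposition gadget, is_NCW_decomposition d & width d = w)
  _ (ex_intro2 _ _ _ ncw_is_NCW erefl).
have gadget_gt0 : 0 < #|gadget| by apply/card_gt0P; exists (inl true).
have [l [SC0l _]] := @is_minimum_exists
  (fun w => exists2 d : decomposition gadget, is_SC0_decomposition d & width d = w)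
  _ (ex_intro2 _ _ _ (trivial_is_SC0 gadget_gt0) erefl).
exists gadget, k, l; split=> //; split=> //.
apply: leq_ltn_trans (leq_trans le_k ncw_width) _.
by have [[d dSC0 <-] _] := SC0l; exact: SC0_width_gt3.
Qed.
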